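(* Let $k$ be an infinite field and let $R$ be a finite-dimensional $k$-algebra. Let $S = \mathrm{soc}({}_R R)$ be the left socle of $R$ and let $\bar R = R/\mathrm{rad}\,R$. Then $R$ is a symmetric $k$-algebra if and only if both of the following hold: $S \simeq \bar R$ as $(R,R)$-bimodules, and $[R,R]$ contains no nonzero left ideals of $R$.
   Context: Algebras are associative with identity. $\mathrm{rad}\,R$ is the Jacobson radical of $R$; $\mathrm{soc}({}_R R)$ is the sum of all minimal left ideals of $R$ (a two-sided ideal, hence an $(R,R)$-bimodule). $[R,R] = \{\sum_i (r_i s_i - s_i r_i) : r_i, s_i \in R\}$ (finite sums) is the additive subgroup generated by commutators. For a finite-dimensional $k$-algebra $R$, the $k$-dual $\hat R = \mathrm{Hom}_k(R,k)$ is an $(R,R)$-bimodule via $(rf)(s) = f(sr)$ and $(fr)(s) = f(rs)$. $R$ is a symmetric $k$-algebra if $R \simeq \hat R$ as $(R,R)$-bimodules; equivalently, there is a $k$-linear functional $\lambda : R \to k$ whose kernel contains no nonzero left ideal and which satisfies $\lambda(rs) = \lambda(sr)$ for all $r,s \in R$. *)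

(* Defs.v *)
(* MathComp, with the classical sets and quantifiers of mathcomp.classical. *)
From HB Require Import structures.
From mathcomp Require Import all_boot all_algebra all_field.
From mathcomp Require Import boolp classical_sets cardinality.

Set Implicit Arguments.
Unset Strict Implicit.
Unset Printing Implicit Defensive.

Import GRing.Theory.

Local Open Scope ring_scope.
Local Open Scope quotient_scope.
Local Open Scope classical_set_scope.

HB.mixin Record Lmodule_isBimodule (A B : pzRingType) M of GRing.Lmodule A M := {
  rscale : M -> B -> M;
  rscaleA : forall m a b, rscale (rscale m a) b = rscale m (a * b);
  rscale1 : forall m, rscale m 1 = m;
  rscaleDl : forall m n b, rscale (m + n) b = rscale m b + rscale n b;
  rscaleDr : forall m a b, rscale m (a + b) = rscale m a + rscale m b;
  rscaleZl : forall (a : A) m b, rscale (a *: m) b = a *: rscale m b }.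

#[short(type="bimodType")]
HB.structure Definition Bimodule (A B : pzRingType) :=
  { M of GRing.Lmodule A M & Lmodule_isBimodule A B M }.

Definition bimod_isomorphic (A B : pzRingType) (M N : bimodType A B) : Prop :=
  exists f : {linear M -> N},
    bijective f /\ forall m b, f (rscale m b) = rscale (f m) b.

Section RingNotions.
Variable R : nzRingType.

Definition left_ideal (I : set R) : Prop :=
  [/\ I 0, forall x y, I x -> I y -> I (x - y) & forall a x, I x -> I (a * x)].

Definition maximal_left_ideal (I : set R) : Prop :=
  [/\ left_ideal I, I <> setT &
      forall J, left_ideal J -> I `<=` J -> J = I \/ J = setT].

Definition minimal_left_ideal (I : set R) : Prop :=
  [/\ left_ideal I, I <> [set 0] &
      forall J, left_ideal J -> J `<=` I -> J = [set 0] \/ J = I].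

Definition jacobson_radical : set R :=
  [set x | forall M, maximal_left_ideal M -> M x].

(* The elements of the sum of all the minimal left ideals are the finite sums
   of elements, each of which lies in some minimal left ideal.                *)
Definition left_socle : set R :=
  [set x | exists2 s : seq R,
     forall y, y \in s -> exists2 L, minimal_left_ideal L & L y
     & x = \sum_(y <- s) y].

Definition commutator_subgroup : set R :=
  [set x | exists s : seq (R * R), x = \sum_(p <- s) (p.1 * p.2 - p.2 * p.1)].

Lemma left_idealD (I : set R) x y : left_ideal I -> I x -> I y -> I (x + y).
Proof.
case=> I0 IB _ Ix Iy; rewrite -[y]opprK; apply: (IB) => //.
by rewrite -sub0r; apply: IB.
Qed.

Lemma jacobson_radical_left_ideal : left_ideal jacobson_radical.
Proof.
split=> [M [[]] // | x y Jx Jy M mM | a x Jx M mM].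
  by have [[_ MB _] _ _] := mM; apply: MB; [exact: Jx | exact: Jy].
by have [[_ _ MM] _ _] := mM; apply: MM; exact: Jx.
Qed.

Lemma jacobson_radicalMr x r :
  jacobson_radical x -> jacobson_radical (x * r).
Proof.
move=> Jx M mM; have [lM MT maxM] := mM; have [M0 MB MM] := lM.
have [Mr|nMr] := pselect (M r); first exact: MM.
pose N : set R := [set z | M (z * r)].
have lN : left_ideal N.
  split=> [|y z Ny Nz|a y Ny]; rewrite /N /=.
  - by rewrite mul0r.
  - by rewrite mulrBl; apply: MB.
  - by rewrite -mulrA; apply: MM.
suff mN : maximal_left_ideal N by exact: (Jx N mN).
split=> // [NT|L lL sNL].
  have : N 1 by rewrite NT.
  by rewrite /N /= mul1r.
have [L0 LB LM] := lL.
pose K : set R := [set z | exists2 l, L l & M (z - l * r)].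
have lK : left_ideal K.
  split=> [|y z [l Ll Ml] [l' Ll' Ml']|a y [l Ll Ml]].
  - by exists 0; rewrite // mul0r subr0.
  - exists (l - l'); first exact: LB.
    suff -> : y - z - (l - l') * r = (y - l * r) - (z - l' * r) by exact: MB.
    by rewrite mulrBl !opprD !opprK addrACA.
  - by exists (a * l); [exact: LM | rewrite -mulrA -mulrBr; exact: MM].
have sMK : M `<=` K by move=> z Mz; exists 0; rewrite // mul0r subr0.
have [KM|KT] := maxM _ lK sMK.
  left; apply/seteqP; split=> // l Ll.
  by rewrite /N /= -KM; exists l; rewrite // subrr.
right; apply/seteqP; split=> // z _.
have [l Ll] : K r by rewrite KT.
rewrite -{1}[r]mul1r -mulrBl => /sNL L1.
by rewrite -[z]mulr1 -[1](subrK l); apply: LM; exact: left_idealD.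
Qed.

Lemma left_socle_left_ideal : left_ideal left_socle.
Proof.
have SM a x : left_socle x -> left_socle (a * x).
  move=> [s hs ->]; exists [seq a * y | y <- s].
    move=> _ /mapP[y /hs[L mL Ly] ->]; exists L => //.
    by have [[_ _ LM] _ _] := mL; exact: LM.
  by rewrite big_map mulr_sumr.
split=> // [|x y [s hs ->]]; first by exists [::]; rewrite ?big_nil.
move=> /(SM (-1)); rewrite mulN1r => -[t ht ->].
exists (s ++ t); last by rewrite big_cat.
by move=> z; rewrite mem_cat => /orP[/hs|/ht].
Qed.

Lemma left_socleMr x r : left_socle x -> left_socle (x * r).
Proof.
case=> s hs ->; rewrite mulr_suml; elim: s hs => [_|y s IHs hs].
  by rewrite big_nil; case: left_socle_left_ideal.
rewrite big_cons; apply: (left_idealD left_socle_left_ideal); last first.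
  by apply: IHs => z zs; apply: hs; rewrite inE zs orbT.
have [L [lL _ minL] Ly] := hs y (mem_head _ _).
have [yr0|yr0] := eqVneq (y * r) 0.
  by rewrite yr0; case: left_socle_left_ideal.
exists [:: y * r]; last by rewrite big_seq1.
move=> _ /[!inE] /eqP->; pose Lr : set R := [set z * r | z in L].
exists Lr; last by exists y.
have [L0 LB LM] := lL; split.
- split=> [|_ _ [a La <-] [b Lb <-]|c _ [a La <-]].
  + by exists 0; rewrite // mul0r.
  + by exists (a - b); rewrite ?mulrBl //; exact: LB.
  + by exists (c * a); rewrite ?mulrA //; exact: LM.
- move=> Lr0; have : Lr (y * r) by exists y.
  by rewrite Lr0 => /= /eqP; rewrite (negPf yr0).
move=> K lK sKLr; have [K0 KB KM] := lK.
have lK' : left_ideal [set z | L z /\ K (z * r)].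
  split=> [|a b [La Ka] [Lb Kb]|c a [La Ka]].
  + by split; rewrite ?mul0r.
  + by split; rewrite ?mulrBl; [exact: LB | exact: KB].
  + by split; rewrite -?mulrA; [exact: LM | exact: KM].
have [K'0|K'L] := minL _ lK' (fun z => @proj1 _ _).
- left; apply/seteqP; split=> [z Kz|z ->//].
  have [w Lw wz] := sKLr z Kz.
  have : [set z | L z /\ K (z * r)] w by split=> //=; rewrite wz.
  by rewrite K'0 => /= w0; rewrite -wz w0 mul0r.
- right; apply/seteqP; split=> // _ [w Lw <-].
  have : [set z | L z /\ K (z * r)] w by rewrite K'L.
  by case.
Qed.

End RingNotions.

Arguments commutator_subgroup : clear implicits.

Section Bimodules.
Variable R : nzRingType.

Fact regular_rscaleZl (a : R) (m : R^o) (b : R) :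
  ((a *: m) * b : R^o) = a *: (m * b : R^o).
Proof. by rewrite /GRing.scale /= mulrA. Qed.

HB.instance Definition _ := Lmodule_isBimodule.Build R R R^o
  (fun m a b => esym (mulrA m a b)) (@mulr1 R) (@mulrDl R) (@mulrDr R)
  regular_rscaleZl.

Definition socle_pred : {pred R^o} := fun x => `[< left_socle x >].

Fact socle_pred_submod_closed : submod_closed socle_pred.
Proof.
have lS := left_socle_left_ideal R; have [S0 SB SM] := lS.
split=> [|a x y /asboolP Sx /asboolP Sy]; apply/asboolP => //.
by apply: left_idealD => //; exact: SM.
Qed.

HB.instance Definition _ :=
  GRing.isSubmodClosed.Build R R^o socle_pred socle_pred_submod_closed.

Record socle_bimod := Socle { socle_val : R^o; _ : socle_val \in socle_pred }.

HB.instance Definition _ := [isSub for socle_val].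
HB.instance Definition _ := [Choice of socle_bimod by <:].
HB.instance Definition _ := [SubChoice_isSubLmodule of socle_bimod by <:].

Fact socle_rscale_subproof (m : socle_bimod) (b : R) : val m * b \in socle_pred.
Proof. by apply/asboolP/left_socleMr/asboolP/(valP m). Qed.

Definition socle_rscale (m : socle_bimod) (b : R) : socle_bimod :=
  Socle (socle_rscale_subproof m b).

Fact socle_rscaleA m a b :
  socle_rscale (socle_rscale m a) b = socle_rscale m (a * b).
Proof. by apply: val_inj; rewrite /= mulrA. Qed.
Fact socle_rscale1 m : socle_rscale m 1 = m.
Proof. by apply: val_inj; rewrite /= mulr1. Qed.
Fact socle_rscaleDl m n b :
  socle_rscale (m + n) b = socle_rscale m b + socle_rscale n b.
Proof. by apply: val_inj; rewrite /= mulrDl. Qed.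
Fact socle_rscaleDr m a b :
  socle_rscale m (a + b) = socle_rscale m a + socle_rscale m b.
Proof. by apply: val_inj; rewrite /= mulrDr. Qed.
Fact socle_rscaleZl (a : R) m b :
  socle_rscale (a *: m) b = a *: socle_rscale m b.
Proof. by apply: val_inj; rewrite /= regular_rscaleZl. Qed.

HB.instance Definition _ := Lmodule_isBimodule.Build R R socle_bimod
  socle_rscaleA socle_rscale1 socle_rscaleDl socle_rscaleDr socle_rscaleZl.

Definition radical_pred : {pred R} := fun x => `[< jacobson_radical x >].

Fact radical_pred_zmod_closed : zmod_closed radical_pred.
Proof.
have [J0 JB _] := jacobson_radical_left_ideal R.
by split=> [|x y /asboolP Jx /asboolP Jy]; apply/asboolP => //; exact: JB.
Qed.

HB.instance Definition _ :=
  GRing.isZmodClosed.Build R radical_pred radical_pred_zmod_closed.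

Definition radical_quot := Quotient.quot radical_pred.

HB.instance Definition _ := GRing.Zmodule.on radical_quot.
HB.instance Definition _ := ZmodQuotient.on radical_quot.

(* Choosing representatives is harmless, see pi_radical_[lr]scale below.      *)
Definition radical_lscale (a : R) (m : radical_quot) : radical_quot :=
  \pi_radical_quot (a * repr m).
Definition radical_rscale (m : radical_quot) (b : R) : radical_quot :=
  \pi_radical_quot (repr m * b).

Fact eq_pi_radical (x y : R) :
  jacobson_radical (x - y) -> \pi_radical_quot x = \pi_radical_quot y.
Proof. by move=> Jxy; apply/eqP; rewrite -Quotient.idealrBE; apply/asboolP. Qed.

Fact repr_pi_radical (x : R) : jacobson_radical (repr (\pi_radical_quot x) - x).
Proof.
by apply/asboolP; rewrite -[asbool _]/(_ \in radical_pred) Quotient.idealrBE reprK.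
Qed.

Fact pi_radical_lscale (a x : R) :
  radical_lscale a (\pi_radical_quot x) = \pi_radical_quot (a * x).
Proof.
apply: eq_pi_radical; rewrite -mulrBr.
have [_ _ JM] := jacobson_radical_left_ideal R.
by apply: JM; exact: repr_pi_radical.
Qed.

Fact pi_radical_rscale (x b : R) :
  radical_rscale (\pi_radical_quot x) b = \pi_radical_quot (x * b).
Proof.
apply: eq_pi_radical; rewrite -mulrBl.
by apply: jacobson_radicalMr; exact: repr_pi_radical.
Qed.

Fact radical_lscaleA a b m :
  radical_lscale a (radical_lscale b m) = radical_lscale (a * b) m.
Proof.
elim/quotW: m => x.
by rewrite (pi_radical_lscale b) (pi_radical_lscale a) pi_radical_lscale mulrA.
Qed.
Fact radical_lscale1 : left_id 1 radical_lscale.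
Proof. by elim/quotW=> x; rewrite pi_radical_lscale mul1r. Qed.
Fact radical_lscaleDr : right_distributive radical_lscale +%R.
Proof.
move=> a; elim/quotW=> x; elim/quotW=> y.
rewrite -[_ + _](raddfD \pi_radical_quot) !(pi_radical_lscale a) mulrDr.
exact: raddfD.
Qed.
Fact radical_lscaleDl m : {morph radical_lscale^~ m : a b / a + b}.
Proof.
elim/quotW: m => x a b.
by rewrite !(pi_radical_lscale _ x) mulrDl; exact: raddfD.
Qed.

HB.instance Definition _ := GRing.Zmodule_isLmodule.Build R radical_quot
  radical_lscaleA radical_lscale1 radical_lscaleDr radical_lscaleDl.

Fact radical_rscaleA m a b :
  radical_rscale (radical_rscale m a) b = radical_rscale m (a * b).
Proof.
elim/quotW: m => x.
by rewrite (pi_radical_rscale x a) (pi_radical_rscale _ b) pi_radical_rscale mulrA.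
Qed.
Fact radical_rscale1 m : radical_rscale m 1 = m.
Proof. by elim/quotW: m => x; rewrite pi_radical_rscale mulr1. Qed.
Fact radical_rscaleDl m n b :
  radical_rscale (m + n) b = radical_rscale m b + radical_rscale n b.
Proof.
elim/quotW: m => x; elim/quotW: n => y.
rewrite -[_ + _](raddfD \pi_radical_quot) !(pi_radical_rscale _ b) mulrDl.
exact: raddfD.
Qed.
Fact radical_rscaleDr m a b :
  radical_rscale m (a + b) = radical_rscale m a + radical_rscale m b.
Proof.
elim/quotW: m => x.
by rewrite !(pi_radical_rscale x) mulrDr; exact: raddfD.
Qed.
Fact radical_rscaleZl (a : R) m b :
  radical_rscale (a *: m) b = a *: radical_rscale m b.
Proof.
elim/quotW: m => x; rewrite -![_ *: _]/(radical_lscale _ _).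
by rewrite (pi_radical_lscale a x) (pi_radical_rscale x b)
  (pi_radical_rscale _ b) (pi_radical_lscale a _) mulrA.
Qed.

HB.instance Definition _ := Lmodule_isBimodule.Build R R radical_quot
  radical_rscaleA radical_rscale1 radical_rscaleDl radical_rscaleDr
  radical_rscaleZl.

End Bimodules.

Section Symmetric.
Variables (k : fieldType) (R : falgType k).

(* An alias: 'Hom(R, k^o) is canonically a k-module, whereas here *: is the
   left action of R, (r *: f) s = f (s * r).                                  *)
Definition dual_bimod := 'Hom(R, k^o).

HB.instance Definition _ := GRing.Zmodule.on dual_bimod.

Definition dual_lscale (r : R) (f : dual_bimod) : dual_bimod := (f \o amulr r)%VF.
Definition dual_rscale (f : dual_bimod) (r : R) : dual_bimod := (f \o amull r)%VF.

Lemma dual_lscaleE r (f : dual_bimod) s : dual_lscale r f s = f (s * r).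
Proof. by rewrite comp_lfunE lfunE. Qed.
Lemma dual_rscaleE (f : dual_bimod) r s : dual_rscale f r s = f (r * s).
Proof. by rewrite comp_lfunE lfunE. Qed.

Fact dual_lscaleA a b f : dual_lscale a (dual_lscale b f) = dual_lscale (a * b) f.
Proof. by apply/lfunP => s; rewrite !dual_lscaleE mulrA. Qed.
Fact dual_lscale1 : left_id 1 dual_lscale.
Proof. by move=> f; apply/lfunP => s; rewrite dual_lscaleE mulr1. Qed.
Fact dual_lscaleDr : right_distributive dual_lscale +%R.
Proof. by move=> a f g; apply/lfunP=> s; rewrite add_lfunE !dual_lscaleE add_lfunE. Qed.
Fact dual_lscaleDl f : {morph dual_lscale^~ f : a b / a + b}.
Proof.
by move=> a b; apply/lfunP => s; rewrite add_lfunE !dual_lscaleE mulrDr raddfD.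
Qed.

HB.instance Definition _ := GRing.Zmodule_isLmodule.Build R dual_bimod
  dual_lscaleA dual_lscale1 dual_lscaleDr dual_lscaleDl.

Fact dual_rscaleA f a b : dual_rscale (dual_rscale f a) b = dual_rscale f (a * b).
Proof. by apply/lfunP => s; rewrite !dual_rscaleE mulrA. Qed.
Fact dual_rscale1 f : dual_rscale f 1 = f.
Proof. by apply/lfunP => s; rewrite dual_rscaleE mul1r. Qed.
Fact dual_rscaleDl f g b :
  dual_rscale (f + g) b = dual_rscale f b + dual_rscale g b.
Proof. by apply/lfunP => s; rewrite add_lfunE !dual_rscaleE add_lfunE. Qed.
Fact dual_rscaleDr f a b :
  dual_rscale f (a + b) = dual_rscale f a + dual_rscale f b.
Proof.
by apply/lfunP => s; rewrite add_lfunE !dual_rscaleE mulrDl raddfD.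
Qed.
Fact dual_rscaleZl (a : R) f b :
  dual_rscale (a *: f) b = a *: dual_rscale f b.
Proof.
apply/lfunP => s; rewrite -![_ *: _]/(dual_lscale _ _).
by rewrite !(dual_rscaleE, dual_lscaleE) mulrA.
Qed.

HB.instance Definition _ := Lmodule_isBimodule.Build R R dual_bimod
  dual_rscaleA dual_rscale1 dual_rscaleDl dual_rscaleDr dual_rscaleZl.

Definition symmetric_algebra : Prop :=
  bimod_isomorphic (R^o : bimodType R R) (dual_bimod : bimodType R R).

End Symmetric.

(* Main.v *)
(* Write [J] for the radical and [S] for the left socle, which is the right
   annihilator of [J].  An isomorphism between [S] and [R / J] amounts to an
   element [u] of [S] that commutes with [R], generates [S], and is killed exactly
   by [J]; symmetry amounts to a trace form with no nonzero left ideal in its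
   kernel.

   Since [k] is infinite and [R / J] is semisimple, a linear space of trace forms
   that vanish on [J] and separate from 0 the left ideals strictly above [J]
   contains a form whose kernel has no left ideal outside [J]: perturbing a form
   by a generic multiple of another one shrinks the largest ideal in its kernel.

   If [f] is a symmetrizing form, apply this to all the forms that vanish on
   [[R, R] + J]; the outcome is [f (_ * u)] for the required [u].  They separate
   left ideals because [[R, R] + J] contains no left ideal outside [J], and this
   holds because a nonzero finite-dimensional algebra is never spanned by its
   commutators.  Conversely, given [u], apply it to the forms [f (_ * u)] with [f]
   vanishing on [[R, R]]: the hypothesis on [[R, R]] says that they separate. *)
Require Import Defs.
From HB Require Import structures.
From mathcomp Require Import all_boot all_algebra all_field.
From mathcomp Require Import boolp classical_sets cardinality.

Set Implicit Arguments.
Unset Strict Implicit.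
Unset Printing Implicit Defensive.

Import GRing.Theory.

Local Open Scope ring_scope.
Local Open Scope classical_set_scope.

(** * Minimality and linear algebra over a field *)

Lemma ex_minimizer (T : Type) (P : T -> Prop) (m : T -> nat) :
  (exists x, P x) -> exists2 x, P x & forall y, P y -> (m x <= m y)%N.
Proof.
move=> [x0 Px0]; pose Q n := `[< exists2 x, P x & m x = n >].
have exQ : exists n, Q n by exists (m x0); apply/asboolP; exists x0.
have [n /asboolP[x Px <-] min_n] := ex_minnP exQ.
by exists x => // y Py; apply: min_n; apply/asboolP; exists y.
Qed.

(** A subspace inside [P] of least codimension exhausts [P], because adjoining the line of any [x]
    in [P] stays inside [P]. *)
Lemma vspace_of_set (K : fieldType) (V : vectType K) (P : set V) :
    P 0 -> (forall c x y, P x -> P y -> P (c *: x + y)) ->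
  exists U : {vspace V}, forall x, x \in U <-> P x.
Proof.
move=> P0 PZD.
pose inP (U : {vspace V}) := forall x, x \in U -> P x.
have [|U sUP maxU] := @ex_minimizer _ inP (fun U => \dim {:V} - \dim U)%N.
  by exists 0%VS => x; rewrite memv0 => /eqP->.
exists U => x; split=> [|Px]; first exact: sUP.
have sUxP : inP (U + <[x]>)%VS.
  move=> _ /memv_addP[u Uu [_ /vlineP[c ->] ->]].
  by rewrite addrC; apply: PZD => //; exact: sUP.
have := maxU _ sUxP; rewrite leq_sub2lE => [dimUx|]; last exact/dimvS/subvf.
have /eqP-> : U == (U + <[x]>)%VS by rewrite eqEdim addvSl.
by apply: (subvP (addvSr _ _)); exact: memv_line.
Qed.

(** The vector [x - projv W x] is nonzero; one of its nonzero coordinates, composed with the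
    projection that kills [W], is the functional. *)
Lemma ex_functional (K : fieldType) (V : vectType K) (W : {vspace V}) x :
    x \notin W ->
  exists2 f : 'Hom(V, K^o), forall w, w \in W -> f w = 0 & f x != 0.
Proof.
move=> nWx; pose y := x - projv W x.
have y0 : y != 0.
  by apply: contraNneq nWx => /subr0_eq ->; exact: memv_proj.
have [i yi] : exists i, coord (vbasis {:V}) i y != 0.
  apply/existsP; apply: contraR y0 => /existsPn yi.
  rewrite (coord_vbasis (memvf y)) big1 // => i _.
  by have /negPn/eqP-> := yi i; rewrite scale0r.
pose f := (linfun (coord (vbasis {:V}) i : V -> K^o) \o (\1 - projv W))%VF.
have fE v : f v = coord (vbasis {:V}) i (v - projv W v).
  by rewrite comp_lfunE add_lfunE opp_lfunE id_lfunE lfunE.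
exists f => [w Ww|]; rewrite fE //.
by rewrite projv_id // subrr linear0.
Qed.

(** A nonconstant divisor of least size is irreducible, so a root of it can be adjoined to [K]. *)
Lemma ex_root_extension (K : fieldType) (p : {poly K}) : (1 < size p)%N ->
  exists (L : fieldExtType K) (z : L), root (map_poly (in_alg L) p) z.
Proof.
move=> sz_p; pose P (q : {poly K}) := (1 < size q)%N && (q %| p).
have [|q /andP[sz_q q_p] min_q] := @ex_minimizer _ P (fun q => size q).
  by exists p; rewrite /P sz_p dvdpp.
have irr_q : irreducible_poly q.
  split=> // d sz_d d_q; rewrite -dvdp_size_eqp // eqn_leq.
  have q0 : q != 0 by rewrite -size_poly_gt0 ltnW.
  rewrite dvdp_leq //= min_q // /P (dvdp_trans d_q) // andbT ltn_neqAle eq_sym.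
  by rewrite sz_d size_poly_gt0 (dvdpN0 d_q).
have [L _ [z qz _]] := irredp_FAdjoin irr_q.
by exists L, z; have /dvdpP[d ->] := q_p; rewrite rmorphM rootM qz orbT.
Qed.

(** * Matrix representations on subquotients *)

Section Subquotient.
Variables (K : fieldType) (V : vectType K) (A : nzRingType).
Variables (act : A -> 'End(V)) (U J : {vspace V}).
Hypothesis act1 : forall v, act 1 v = v.
Hypothesis actD : forall a b v, act (a + b) v = act a v + act b v.
Hypothesis actM : forall a b v, act (a * b) v = act b (act a v).
Hypothesis sJU : (J <= U)%VS.
Hypothesis actU : forall a v, v \in U -> act a v \in U.
Hypothesis actJ : forall a v, v \in J -> act a v \in J.

(** The matrices describe the action on [U / J] in a basis of a complement of [J]. The second clause
    turns congruences modulo [J] into equalities of matrices. *)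
Lemma subquotient_rep : exists rho : {rmorphism A -> 'M[K]_(\dim U - \dim J)},
  forall a b, (forall v, v \in U -> act a v - act b v \in J) -> rho a = rho b.
Proof.
pose C := (U :\: J)%VS; pose X := vbasis C; pose p := addv_pi1 U J.
have <- : \dim C = (\dim U - \dim J)%N.
  by rewrite -(dimv_cap_compl U J) (capv_idPr sJU) addKn.
have XC i : X`_i \in C.
  have [ltin|/(nth_default 0)->] := ltnP i (size X); last exact: mem0v.
  by apply: vbasis_mem; exact: mem_nth.
have sCU : {subset C <= U} by apply/subvP; exact: diffvSl.
have pC v : v \in C -> p v = v by apply: daddv_pi_id; exact: capv_diff.
have pP v : v \in U -> v - p v \in J.
  move=> Uv; have : v \in (U + J)%VS by rewrite (subvP (addvSl _ _)).
  move=> /addv_pi1_pi2 vE; rewrite -[X in X - _]vE addrC addKr.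
  exact: memv_pi2.
have pJ v : v \in J -> p v = 0.
  move=> Jv; have : v \in (U + J)%VS by rewrite (subvP (addvSr _ _)).
  by move=> /addv_pi1_pi2; rewrite addv_pi2_id // -/p -[RHS]add0r => /addIr.
(* [q] gives the coordinates of a class modulo [J]; [vec] below lifts coordinates back to [C]. *)
pose q v : 'rV[K]_(\dim C) := \row_j coord X j (p v).
have qD v w : q (v + w) = q v + q w.
  by apply/rowP=> j; rewrite !mxE !linearD.
have qB v w : q (v - w) = q v - q w.
  by apply/rowP=> j; rewrite !mxE !linearB.
have qJ v w : v - w \in J -> q v = q w.
  move=> Jvw; apply/eqP; rewrite -subr_eq0 -qB; apply/eqP/rowP=> j.
  by rewrite !mxE pJ // linear0.
pose vec (w : 'rV[K]_(\dim C)) := \sum_i w 0 i *: X`_i.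
have vecC w : vec w \in C by apply: memv_suml => i _; exact: memvZ.
have qvec w : q (vec w) = w.
  apply/rowP => j; rewrite mxE pC // coord_sum_free //.
  exact: basis_free (vbasisP C).
have vecq v : v \in U -> v - vec (q v) \in J.
  move=> Uv; suff -> : vec (q v) = p v by exact: pP.
  rewrite [p v](@coord_vbasis _ _ _ C).
    by apply: eq_bigr => i _; rewrite mxE.
  exact: memv_pi.
pose rho a : 'M[K]_(\dim C) := \matrix_(i, j) coord X j (p (act a X`_i)).
have qvecM a w : q (act a (vec w)) = w *m rho a.
  apply/rowP=> j; rewrite !mxE !linear_sum; apply: eq_bigr => i _.
  by rewrite !linearZ /= mxE.
have qact : forall a v, v \in U -> q (act a v) = q v *m rho a.
  move=> a v Uv; rewrite -qvecM; apply: qJ; rewrite -linearB; apply: actJ.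
  exact: vecq.
have rhoE a b : (forall v, v \in U -> act a v - act b v \in J) -> rho a = rho b.
  move=> ab; apply/row_matrixP => i; rewrite !rowE -!qvecM.
  by apply: qJ; apply: ab; exact: sCU.
have rho_zmod : zmod_morphism rho.
  move=> a b; apply/eqP; rewrite eq_sym subr_eq eq_sym; apply/eqP.
  apply/row_matrixP => i; rewrite !rowE mulmxDr -!qvecM -qD -actD.
  by rewrite subrK.
have rho_mon : monoid_morphism rho.
  split=> [|a b]; apply/row_matrixP => i; rewrite !rowE.
    by rewrite -qvecM act1 qvec mulmx1.
  rewrite -[rho a * _]/(rho a *m _) mulmxA -!qvecM actM qact //.
  exact: actU (sCU _ (vecC _)).
pose rhoZ := GRing.isZmodMorphism.Build _ _ rho rho_zmod.
pose rhoM := GRing.isMonoidMorphism.Build _ _ rho rho_mon.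
pose r : {rmorphism A -> 'M[K]_(\dim C)} := HB.pack rho rhoZ rhoM.
by exists r.
Qed.

End Subquotient.

(** * Linear spans of representations and their traces *)

Section RepSpan.
Variables (A : nzRingType) (K : fieldType) (n : nat) (rho : A -> 'M[K]_n).

(** The scalars come from [K] while [A] is a bare ring, so that [K] can be enlarged with [A] kept
    fixed. *)
Definition rep_span : set 'M[K]_n :=
  [set M | exists s : seq (K * A), M = \sum_(p <- s) p.1 *: rho p.2].

Lemma rep_span_rep a : rep_span (rho a).
Proof. by exists [:: (1, a)]; rewrite big_seq1 scale1r. Qed.

Lemma rep_spanZD c M N : rep_span M -> rep_span N -> rep_span (c *: M + N).
Proof.
move=> [s ->] [t ->]; exists ([seq (c * p.1, p.2) | p <- s] ++ t).
rewrite big_cat big_map scaler_sumr; congr (_ + _).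
by apply: eq_bigr => p _; rewrite scalerA.
Qed.

Lemma rep_span0 : rep_span 0.
Proof. by exists [::]; rewrite big_nil. Qed.

Lemma mxtrace_rep_span M :
  (forall a, \tr (rho a) = 0) -> rep_span M -> \tr M = 0.
Proof.
move=> tr0 [s ->]; rewrite linear_sum big1 // => p _.
by rewrite linearZ /= tr0 mulr0.
Qed.

End RepSpan.

Lemma rep_spanM (A : nzRingType) (K : fieldType) (n : nat)
    (rho : {rmorphism A -> 'M[K]_n}) M N :
  rep_span rho M -> rep_span rho N -> rep_span rho (M *m N).
Proof.
move=> [s ->] sN; rewrite mulmx_suml; elim/big_ind: _ => [|X Y sX sY|p _].
- exact: rep_span0.
- by rewrite -[X]scale1r; exact: rep_spanZD.
have [t ->] := sN; rewrite mulmx_sumr; elim/big_ind: _ => [|X Y sX sY|q _].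
- exact: rep_span0.
- by rewrite -[X]scale1r; exact: rep_spanZD.
rewrite -scalemxAl -scalemxAr scalerA -[_ *m _]rmorphM -[_ *: _]addr0.
by apply: rep_spanZD; [exact: rep_span_rep | exact: rep_span0].
Qed.

Lemma rep_span_map (A : nzRingType) (K L : fieldType) (f : {rmorphism K -> L})
    (n : nat) (rho : A -> 'M[K]_n) M :
  rep_span rho M -> rep_span (map_mx f \o rho) (map_mx f M).
Proof.
move=> [s ->]; exists [seq (f p.1, p.2) | p <- s].
by rewrite rmorph_sum big_map; apply: eq_bigr => p _; exact: map_mxZ.
Qed.

(* Induction on the degree and on the rank of a nonzero [T] in the span, all of
   whose elements have trace 0.  In an irreducible representation, if each
   [T M T] is a multiple of [T] then [T] has rank one and some [T M] has nonzero
   trace; otherwise [T M T - z T] has smaller rank for [z] an eigenvalue, in a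
   field extension, of the map that [M T] induces on the row space of [T]. *)
Lemma no_perfect_rep_span (A : nzRingType) n r (K : fieldType)
    (rho : {rmorphism A -> 'M[K]_n}) T :
    (forall a, exists2 c, commutator_subgroup A c & rho a = rho c) ->
  rep_span rho T -> T != 0 -> (\rank T <= r)%N -> False.
Proof.
elim/ltn_ind: n => n IHn in r K rho T *.
elim/ltn_ind: r => r IHr in K rho T * => perf sT T0 rkT.
have tr0 a : \tr (rho a) = 0.
  have [c [s ->] ->] := perf a; rewrite rmorph_sum linear_sum.
  rewrite big1 // => -[x y] _ /=.
  by rewrite rmorphB !rmorphM /= linearB /= mxtrace_mulC subrr.
pose act a : 'End('rV[K]_n) := linfun (mulmxr (rho a)).
have actE a v : act a v = v *m rho a by rewrite lfunE.
have [[U [Ustable U0 UT]]|irr] := pselect (exists U : {vspace 'rV[K]_n},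
    [/\ forall a v, v \in U -> v *m rho a \in U, U != 0%VS & U != fullv]).
  (* A proper stable subspace carries a representation of smaller degree, to which induction applies
     with the identity as nonzero element. *)
  have [||||||rho' rho'E] := @subquotient_rep K _ A act U 0.
  - by move=> v; rewrite actE rmorph1 mulmx1.
  - by move=> a b v; rewrite !actE rmorphD mulmxDr.
  - by move=> a b v; rewrite !actE rmorphM mulmxA.
  - exact: sub0v.
  - by move=> a v Uv; rewrite actE; exact: Ustable.
  - by move=> a v; rewrite memv0 => /eqP->; rewrite linear0 mem0v.
  have dimU : (\dim U - \dim (0%VS : {vspace 'rV[K]_n}) < n)%N.
    rewrite dimv0 subn0 ltn_neqAle.
    have dimT : \dim {:'rV[K]_n} = n by rewrite dimvf dim_matrix mul1r.
    have := dimvS (subvf U); rewrite {}dimT => -> /=; rewrite andbT.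
    apply: contraNneq UT => dimU; rewrite eqEdim subvf /= dimU.
    by rewrite dimvf dim_matrix mul1r.
  apply: (IHn _ dimU _ K rho' (rho' 1)) (leqnn _).
  - move=> a; have [c cA ac] := perf a; exists c => //; apply: rho'E => v _.
    by rewrite !actE ac subrr mem0v.
  - exact: rep_span_rep.
  - apply/eqP => /(congr1 mxrank); rewrite mxrank0 rmorph1 mxrank1 dimv0 subn0.
    by apply/eqP; rewrite dimv_eq0.
(* The vectors reached from [v] form a stable subspace containing [v], hence everything by
   irreducibility. *)
have trans (v w : 'rV[K]_n) : v != 0 -> exists2 M, rep_span rho M & v *m M = w.
  move=> v0; pose P (w : 'rV[K]_n) := exists2 M, rep_span rho M & v *m M = w.
  have [||U UP] := @vspace_of_set K _ P.
  - by exists 0; rewrite ?mulmx0 //; exact: rep_span0.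
  - move=> c _ _ [M sM <-] [N sN <-]; exists (c *: M + N).
      exact: rep_spanZD.
    by rewrite mulmxDr scalemxAr.
  suff UT : U = fullv by apply/UP; rewrite UT memvf.
  have Uv : v \in U.
    apply/UP; exists (rho 1); first exact: rep_span_rep.
    by rewrite rmorph1 mulmx1.
  apply: contrapT => UnT; apply: irr; exists U; split; last exact/eqP.
    move=> a _ /UP[M sM <-]; apply/UP; exists (M *m rho a); rewrite ?mulmxA //.
    by apply: rep_spanM => //; exact: rep_span_rep.
  by apply: contraNneq v0 => U0; rewrite -memv0 -U0.
have [[M sM nsing]|sing] := pselect (exists2 M, rep_span rho M &
    forall c, T *m M *m T <> c *: T).
  have [C [B CB]] : exists (C : 'M_(n, \rank T)) B, C *m B = T.
    by exists (col_base T), (row_base T); exact: mulmx_base.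
  (* [N] is the matrix of [M *m T] on the row space of [T], in the basis of the rows of [B]. Its
     size [\rank T] is positive, so its characteristic polynomial is not constant. *)
  pose N := B *m M *m C.
  have TMT : T *m M *m T = C *m N *m B.
    by rewrite /N !mulmxA CB -!mulmxA CB.
  have [|L [z]] := @ex_root_extension K (char_poly N).
    by rewrite size_char_poly ltnS lt0n mxrank_eq0.
  rewrite map_char_poly -eigenvalue_root_char => eig_z.
  pose f : {rmorphism K -> L} := in_alg L.
  pose T' := map_mx f C *m (map_mx f N - z%:M) *m map_mx f B.
  have T'E : T' = - z *: map_mx f T + map_mx f (T *m M *m T).
    have -> : map_mx f T = map_mx f C *m map_mx f B by rewrite -map_mxM CB.
    rewrite /T' TMT !map_mxM mulmxBr mulmxBl addrC scaleNr.
    by rewrite mul_mx_scalar scalemxAl.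
  have rkT' : (\rank T' < \rank T)%N.
    apply: (@leq_ltn_trans (\rank (map_mx f N - z%:M))).
      exact: leq_trans (mxrankM_maxl _ _) (mxrankM_maxr _ _).
    rewrite ltn_neqAle rank_leq_row andbT.
    by move: eig_z; rewrite /eigenvalue /eigenspace kermx_eq0.
  apply: (IHr _ (leq_trans rkT' rkT) L (map_mx f \o rho) T') (leqnn _).
  - by move=> a; have [c cA ac] := perf a; exists c => //=; rewrite ac.
  - rewrite T'E; apply: rep_spanZD; apply: rep_span_map => //.
    by apply: rep_spanM => //; exact: rep_spanM.
  (* If [T'] vanished, [z] would be a ratio of entries from [K], and [T *m M *m T] would already be
     a multiple of [T] over [K]. *)
  apply/eqP => T'0; have /matrix0Pn[i [j Tij]] := T0.
  apply: (nsing ((T *m M *m T) i j / T i j)); apply: (@map_mx_inj _ _ f).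
  move: T'E; rewrite T'0 map_mxZ scaleNr addrC => /esym/subr0_eq TMTz.
  rewrite TMTz; congr (_ *: _); apply: (@mulIf _ (f (T i j))).
    by rewrite fmorph_eq0.
  rewrite -rmorphM divfK //; move/matrixP/(_ i j): TMTz.
  by rewrite !mxE.
have {}sing M : rep_span rho M -> exists c, T *m M *m T = c *: T.
  move=> sM; apply: contrapT => nsing; apply: sing; exists M => // c TMT.
  by apply: nsing; exists c.
have /matrix0Pn[i [j0 Tij]] := T0.
have Ti : row i T != 0.
  by apply: contraNneq Tij => /rowP/(_ j0); rewrite !mxE => ->.
(* Every [w] has the form [row i T *m M], and [T *m M *m T] is a multiple of [T]: thus [T] has rank
   one. *)
have mulT w : exists c, w *m T = c *: row i T.
  have [M sM <-] := trans _ w Ti; have [c TMT] := sing M sM; exists c.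
  by rewrite -!row_mul TMT linearZ.
have [u uE] := choice mulT.
have [j uj] : exists j, u (delta_mx 0 j) != 0.
  apply/existsP; apply: contraR Tij => /existsPn u0.
  have /rowP/(_ j0) := uE (delta_mx 0 i); rewrite -rowE !mxE => ->.
  by have /negPn/eqP-> := u0 i; rewrite mul0r.
pose U := \col_j u (delta_mx 0 j).
have TE : T = U *m row i T.
  apply/row_matrixP=> l; rewrite row_mul [LHS]rowE uE; apply/rowP => m.
  by rewrite !mxE big_ord1 !mxE.
(* With this [M], the trace of [T *m M] is the nonzero scalar [u (delta_mx 0 j)]. *)
have [M sM TiM] := trans _ (delta_mx 0 j) Ti.
have := mxtrace_rep_span tr0 (rep_spanM sT sM).
rewrite TE -mulmxA TiM mxtrace_mulC -rowE /mxtrace big_ord1 !mxE.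
by apply/eqP.
Qed.

(** * Left ideals, the radical, the socle and commutators *)

Section LeftIdeals.
Variables (k : fieldType) (R : falgType k).
Local Notation J := (@jacobson_radical R).
Implicit Types I L M N : set R.

Lemma left_ideal_vspace I : left_ideal I ->
  exists U : {vspace R}, forall x, x \in U <-> I x.
Proof.
move=> lI; have [I0 _ IM] := lI; apply: vspace_of_set => // c x y Ix Iy.
by apply: (left_idealD lI) => //; rewrite -mulr_algl; exact: IM.
Qed.

(** Finite dimension supplies the descending chain condition: an ideal of least dimension is
    minimal. *)
Lemma left_ideal_min (P : set R -> Prop) :
    (exists2 I, left_ideal I & P I) ->
  exists I, [/\ left_ideal I, P I &
    forall L, left_ideal L -> P L -> L `<=` I -> L = I].
Proof.
move=> [I0 lI0 PI0].
pose Q (U : {vspace R}) :=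
  exists I, [/\ left_ideal I, P I & forall x, x \in U <-> I x].
have [|U [I [lI PI UI]] minU] := @ex_minimizer _ Q (fun U => \dim U).
  by have [U UI0] := left_ideal_vspace lI0; exists U, I0.
exists I; split=> // L lL PL sLI; have [V VL] := left_ideal_vspace lL.
have dimUV : (\dim U <= \dim V)%N by apply: minU; exists L.
have sVU : (V <= U)%VS by apply/subvP => x /VL/sLI/UI.
have /eqP VU : V == U by rewrite eqEdim sVU.
by apply/seteqP; split=> // x; rewrite -UI -VU VL.
Qed.

Lemma exists_minimal_left_ideal L : left_ideal L -> L <> [set 0] ->
  exists2 M, minimal_left_ideal M & M `<=` L.
Proof.
move=> lL L0.
have [|M [lM [M0 sML] minM]] :=
    @left_ideal_min (fun I => I <> [set 0] /\ I `<=` L).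
  by exists L => //; split.
exists M => //; split=> // I lI sIM.
have [I0|I0] := pselect (I = [set 0]); [by left | right].
by apply: minM => //; split=> //; exact: subset_trans sML.
Qed.

Lemma left_ideal_cap I L :
  left_ideal I -> left_ideal L -> left_ideal (I `&` L).
Proof.
move=> [I0 IB IM] [L0 LB LM]; split=> // [x y [Ix Lx] [Iy Ly]|a x [Ix Lx]].
  by split; [exact: IB | exact: LB].
by split; [exact: IM | exact: LM].
Qed.

Lemma jacobson_radicalMl a x : J x -> J (a * x).
Proof. by case: (jacobson_radical_left_ideal R) => _ _; apply. Qed.

Lemma jacobson_radicalB x y : J x -> J y -> J (x - y).
Proof. by case: (jacobson_radical_left_ideal R) => _ + _; apply. Qed.

Lemma jacobson_radicalD x y : J x -> J y -> J (x + y).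
Proof. exact: left_idealD (jacobson_radical_left_ideal R). Qed.

Lemma maximal_left_ideal_decomp M x y : maximal_left_ideal M -> ~ M x ->
  exists2 m, M m & exists r, y = m + r * x.
Proof.
move=> [lM MT maxM] nMx; have [M0 MB MM] := lM.
pose K : set R := [set z | exists2 m, M m & exists r, z = m + r * x].
have lK : left_ideal K.
  split=> [|_ _ [m Mm [r ->]] [n Mn [s ->]]|a _ [m Mm [r ->]]].
  - by exists 0 => //; exists 0; rewrite mul0r addr0.
  - by exists (m - n); [exact: MB | exists (r - s); rewrite mulrBl opprD addrACA].
  - by exists (a * m); [exact: MM | exists (a * r); rewrite mulrDr mulrA].
have [|KM|KT] := maxM _ lK.
- by move=> m Mm; exists m => //; exists 0; rewrite mul0r addr0.
- by case: nMx; rewrite -KM; exists 0 => //; exists 1; rewrite mul1r add0r.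
- by have : K y by rewrite KT.
Qed.

(* [R / J] is semisimple: a left ideal [N] that contains [J] and is minimal with
   [L + N = R] meets [L] in [J], and then [1 = e + f] with [e] in [L], [f] in [N]. *)
Lemma radical_right_unit L : left_ideal L -> J `<=` L ->
  exists2 e, L e & forall x, L x -> J (x - x * e).
Proof.
move=> lL sJL; have [L0 LB LM] := lL.
pose P N := J `<=` N /\ exists l n, [/\ L l, N n & 1 = l + n].
have [|N [lN [sJN [l [n [Ll Nn ln]]]] minN]] := @left_ideal_min P.
  by exists setT => //; split=> //; exists 0, 1; rewrite add0r.
have [N0 NB NM] := lN.
exists l => // x Lx.
have Lxl : L (x - x * l) by apply: LB => //; exact: LM.
have Nxl : N (x - x * l).
  by rewrite -{1}[x]mulr1 -mulrBr ln addrC addKr; exact: NM.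
move=> M mM; apply: contrapT => nMx.
(* Since [n] differs from an element of [M] by one of [L], the intersection of [N] and [M] still
   adds up with [L] to the whole ring; by minimality it is [N]. *)
have [m Mm [r nE]] := maximal_left_ideal_decomp n mM nMx.
have lNM : left_ideal (N `&` M) by apply: left_ideal_cap => //; case: mM.
have Nm : N m.
  by rewrite -[m](addrK (r * (x - x * l))) -nE; apply: NB => //; exact: NM.
have NMN : N `&` M = N.
  apply: minN => //.
  split=> [y Jy|]; first by split; [exact: sJN | exact: Jy].
  exists (l + r * (x - x * l)), m; split=> //.
    by apply: (left_idealD lL) => //; exact: LM.
  by rewrite ln nE addrAC addrA.
by apply: nMx; rewrite -NMN in Nxl; case: Nxl.
Qed.

(** The annihilator of a nonzero [x] in [L] is a maximal left ideal, because [R * x] is the simple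
    module [L]. *)
Lemma radical_kills_minimal L j x :
  minimal_left_ideal L -> L x -> J j -> j * x = 0.
Proof.
move=> [lL L0 minL] Lx; have [L00 LB LM] := lL.
have [->|x0] := eqVneq x 0; first by rewrite mulr0.
move=> Jj; apply: (Jj [set r | r * x = 0]); split=> [|annT|I lI sannI].
- split=> [|a b /= ax bx|a b /= bx]; first by rewrite /= mul0r.
    by rewrite mulrBl ax bx subrr.
  by rewrite -mulrA bx mulr0.
- have : [set r | r * x = 0] 1 by rewrite annT.
  by rewrite /= mul1r => /eqP; rewrite (negPf x0).
have [I0 IB IM] := lI.
pose Ix : set R := [set r * x | r in I].
have lIx : left_ideal Ix.
  split=> [|_ _ [a Ia <-] [b Ib <-]|a _ [b Ib <-]].
  - by exists 0; rewrite // mul0r.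
  - by exists (a - b); [exact: IB | rewrite mulrBl].
  - by exists (a * b); [exact: IM | rewrite mulrA].
have [|Ix0|IxL] := minL _ lIx.
- by move=> _ [r _ <-]; exact: LM.
- left; apply/seteqP; split=> // r Ir /=.
  by have : Ix (r * x) by [exists r]; rewrite Ix0.
right; apply/seteqP; split=> // a _; rewrite -[a]mulr1; apply: IM.
have [i Ii ix] : Ix x by rewrite IxL.
rewrite -[1](subrK i); apply: (left_idealD lI) => //.
by apply: sannI; rewrite /= mulrBl mul1r ix subrr.
Qed.

(** For the converse, the left ideal of all [r] with [r * x] in the socle contains [J]. With [e] its
    right unit modulo [J], the point is that [x - e * x] vanishes, so that [x = e * x] lies in the
    socle. *)
Lemma left_socleE x : left_socle x <-> forall j, J j -> j * x = 0.
Proof.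
split=> [[s hs ->] j Jj|Jx].
  rewrite mulr_sumr big_seq big1 // => y /hs[L mL Ly].
  exact: radical_kills_minimal mL Ly Jj.
have lS := left_socle_left_ideal R; have [S0 SB SM] := lS.
pose L : set R := [set r | left_socle (r * x)].
have lL : left_ideal L.
  split=> [|a b La Lb|a b Lb]; rewrite /L /=.
  - by rewrite mul0r.
  - by rewrite mulrBl; exact: SB.
  - by rewrite -mulrA; exact: SM.
have [|e Le eP] := radical_right_unit lL.
  by move=> j Jj; rewrite /L /= Jx.
pose y := x - e * x; pose Ry : set R := [set r * y | r in setT].
have lRy : left_ideal Ry.
  split=> [|_ _ [a _ <-] [b _ <-]|a _ [b _ <-]].
  - by exists 0; rewrite // mul0r.
  - by exists (a - b); rewrite // mulrBl.
  - by exists (a * b); rewrite // mulrA.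
have [y0|/eqP y0] := eqVneq y 0.
  by rewrite -[x](subrK (e * x)) -/y y0 add0r.
have [|M mM sMRy] := exists_minimal_left_ideal lRy.
  by move=> Ry0; apply: y0; have : Ry y by [exists 1; rewrite ?mul1r]; rewrite Ry0.
have [[M0 MB MM] Mn0 _] := mM.
case: Mn0; apply/seteqP; split=> [z Mz|z ->//].
have [r _ zE] := sMRy z Mz; rewrite /= -zE.
(* An element [r * y] of a minimal left ideal puts [r - r * e], hence [r], into [L]; then
   [r - r * e] is in [J] and kills [x]. *)
have ryE : r * y = (r - r * e) * x by rewrite /y mulrBr mulrBl mulrA.
have Lr : L r.
  rewrite -[r](subrK (r * e)); apply: (left_idealD lL).
    rewrite /L /= -ryE zE; exists [:: z]; last by rewrite big_seq1.
    by move=> _ /[!inE]/eqP->; exists M.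
  by case: lL => _ _; apply.
by rewrite ryE; apply: Jx; exact: eP.
Qed.

(* Two-sided as soon as [W] contains the commutators, since [(r * x) * s] and
   [s * (r * x)] then agree modulo [W]. *)
Definition ideal_core (W : set R) : set R := [set x | forall r, W (r * x)].

Section Core.
Variable W : set R.
Hypotheses (W0 : W 0) (WB : forall x y, W x -> W y -> W (x - y)).

Lemma ideal_core_left_ideal : left_ideal (ideal_core W).
Proof.
split=> [r|x y Wx Wy r|a x Wx r]; first by rewrite mulr0.
  by rewrite mulrBr; apply: WB.
by rewrite mulrA; exact: Wx.
Qed.

Lemma ideal_coreMr x s : (forall a b, W (a * b - b * a)) ->
  ideal_core W x -> ideal_core W (x * s).
Proof.
move=> Wcomm Wx r; rewrite mulrA -[_ * s](subKr (s * (r * x))).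
by apply: WB; [rewrite mulrA; exact: Wx | exact: Wcomm].
Qed.

End Core.

Lemma commutator_subgroupB (x y : R) : commutator_subgroup R x ->
  commutator_subgroup R y -> commutator_subgroup R (x - y).
Proof.
move=> [s ->] [t ->]; exists (s ++ [seq (p.2, p.1) | p <- t]).
rewrite big_cat big_map -sumrN; congr (_ + _).
by apply: eq_bigr => p _; rewrite opprB.
Qed.

Lemma commutator_subgroup_comm a b : commutator_subgroup R (a * b - b * a).
Proof. by exists [:: (a, b)]; rewrite big_seq1. Qed.

Lemma commutator_subgroup0 : commutator_subgroup R 0.
Proof. by exists [::]; rewrite big_nil. Qed.

(** The inverse image of the commutator subgroup of [R / J], described without passing to the
    quotient. *)
Definition commutators_radical : set R :=
  [set x | exists2 c, commutator_subgroup R c & J (x - c)].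

Lemma commutators_radicalB x y : commutators_radical x ->
  commutators_radical y -> commutators_radical (x - y).
Proof.
move=> [c cc Jc] [d cd Jd]; exists (c - d); first exact: commutator_subgroupB.
by rewrite opprD opprK addrACA (addrC (- y)) -(opprB y); exact: jacobson_radicalB.
Qed.

Lemma radical_commutators_radical x : J x -> commutators_radical x.
Proof.
by move=> Jx; exists 0; [exact: commutator_subgroup0 | rewrite subr0].
Qed.

Lemma comm_commutators_radical a b : commutators_radical (a * b - b * a).
Proof.
exists (a * b - b * a); first exact: commutator_subgroup_comm.
by rewrite subrr; case: (jacobson_radical_left_ideal R).
Qed.

(** The core [I] is a two-sided ideal containing [L] and [J]. Were it larger than [J], right
    multiplication on [I / J] would be a nonzero representation in which every element acts as a sum
    of commutators. *)
Lemma left_ideal_commutators_radical L : left_ideal L ->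
  L `<=` commutators_radical -> L `<=` J.
Proof.
move=> lL sLW; have [J0 _ _] := jacobson_radical_left_ideal R.
have W0 := radical_commutators_radical J0.
pose I := ideal_core commutators_radical.
have lI : left_ideal I := ideal_core_left_ideal W0 commutators_radicalB.
have IMr x s : I x -> I (x * s).
  apply: ideal_coreMr; first exact: commutators_radicalB.
  exact: comm_commutators_radical.
have sLI : L `<=` I by move=> x Lx r; apply: sLW; case: lL => _ _; apply.
have sJI : J `<=` I.
  by move=> x Jx r; exact: radical_commutators_radical (jacobson_radicalMl r Jx).
have [e Ie eP] := radical_right_unit lI sJI.
suff Je : J e.
  move=> x /sLI/eP Jx; rewrite -[x](subrK (x * e)); apply: jacobson_radicalD => //.
  exact: jacobson_radicalMl.
apply: contrapT => nJe.
have [U UI] := left_ideal_vspace lI.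
have [V VJ] := left_ideal_vspace (jacobson_radical_left_ideal R).
have sVU : (V <= U)%VS by apply/subvP => x /VJ/sJI/UI.
have dimVU : (\dim V < \dim U)%N.
  rewrite ltn_neqAle dimvS // andbT; apply/negP => /eqP dimVU.
  have /eqP VU : V == U by rewrite eqEdim sVU dimVU /=.
  by apply: nJe; apply/VJ; rewrite VU; exact/UI.
have amulrE a v : amulr a v = v * a by rewrite lfunE.
have [||||||rho rhoE] := @subquotient_rep k R R (@amulr k R) U V.
- by move=> v; rewrite amulrE mulr1.
- by move=> a b v; rewrite !amulrE mulrDr.
- by move=> a b v; rewrite !amulrE mulrA.
- exact: sVU.
- by move=> a v; rewrite !UI amulrE; exact: IMr.
- by move=> a v; rewrite !VJ amulrE; exact: jacobson_radicalMr.
apply: (@no_perfect_rep_span _ _ _ _ rho (rho 1) _ _ _ (leqnn _)).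
(* On [I / J], [a] acts as [a * e], which is congruent modulo [J] to the sum of commutators [c]. *)
- move=> a; have [c cc Jc] := Ie a; exists c => //; apply: rhoE => v /UI Iv.
  rewrite !amulrE VJ -[v * a](subrK (v * a * e)) -addrA.
  apply: jacobson_radicalD; first by apply: eP; exact: IMr.
  by rewrite -mulrA -mulrBr; exact: jacobson_radicalMl.
- exact: rep_span_rep.
- apply/eqP => /(congr1 mxrank); rewrite mxrank0 rmorph1 mxrank1.
  by apply/eqP; rewrite subn_eq0 -ltnNge.
Qed.

End LeftIdeals.

(** * Generic perturbation and trace forms *)

Lemma infinite_field_nonroot (k : fieldType) (p : {poly k}) :
  infinite_set [set: k] -> p != 0 -> exists t, ~~ root p t.
Proof.
move=> k_inf p0; have /infinite_set_fsetP/(_ (size p))[B _ szB] := k_inf.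
have := max_poly_roots (rs := finmap.enum_fset B) p0.
rewrite finmap.fset_uniq ltnNge szB => Broots.
apply: contrapT => nroot.
suff /Broots/(_ isT) : all (root p) (finmap.enum_fset B) by [].
by apply/allP => t _; apply/negPn/negP => pt; apply: nroot; exists t.
Qed.

Lemma det_pencil (k : fieldType) n (A B : 'M[k]_n) :
    infinite_set [set: k] -> \det A != 0 ->
  exists2 t, t != 0 & \det (A + t *: B) != 0.
Proof.
move=> k_inf detA.
pose p := \det (map_mx polyC A + 'X *: map_mx polyC B).
have pE t : p.[t] = \det (A + t *: B).
  rewrite -[p.[t]]/(horner_eval t p) -det_map_mx; congr (\det _).
  by apply/matrixP=> i j; rewrite !mxE /= /horner_eval !hornerE.
have p0 : p != 0.
  by apply: contraNneq detA => p0; rewrite -[A]addr0 -(scale0r B) -pE p0 horner0.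
(* The extra factor ['X] excludes the value 0 of [t]. *)
have [|t] := @infinite_field_nonroot _ ('X * p) k_inf.
  by rewrite mulf_neq0 ?polyX_eq0.
by rewrite rootM negb_or rootX rootE pE => /andP[]; exists t.
Qed.

Section TraceForms.
Variables (k : fieldType) (R : falgType k).
Local Notation J := (@jacobson_radical R).
Local Notation form := 'Hom(R, k^o).
Implicit Types f g : form.

Definition trace_form f := forall a b : R, f (a * b) = f (b * a).

(** The largest left ideal on which [f] vanishes. *)
Definition form_kernel f : set R := ideal_core [set x | f x = 0].

Lemma form_kernel_left_ideal f : left_ideal (form_kernel f).
Proof.
apply: ideal_core_left_ideal => [|x y /= fx fy]; first by rewrite /= linear0.
by rewrite linearB /= fx fy subrr.
Qed.

Lemma form_kernelMr f x s : trace_form f -> form_kernel f x -> form_kernel f (x * s).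
Proof.
move=> tf; apply: ideal_coreMr => [a b /= fa fb|a b /=].
  by rewrite linearB /= fa fb subrr.
by rewrite linearB /= tf subrr.
Qed.

(* Choose [f] in [P] with the smallest kernel [N], and [e] in [N] a right unit
   modulo [J].  If [N] is not [J], some [g] in [P] does not vanish on [N]; on a
   complement [C] of [J] in [{x | x e in J}], [f] is nondegenerate, hence so is
   [f + t g] for some [t <> 0], and the kernel of [f + t g] is then smaller. *)
Lemma exists_trace_form (P : form -> Prop) :
    infinite_set [set: k] -> P 0 ->
    (forall f g t, P f -> P g -> P (f + t *: g)) ->
    (forall f, P f -> trace_form f /\ forall x, J x -> f x = 0) ->
    (forall L : set R, left_ideal L -> J `<=` L -> ~ (L `<=` J) ->
      exists2 f, P f & exists2 x, L x & f x != 0) ->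
  exists2 f, P f & form_kernel f `<=` J.
Proof.
move=> k_inf P0 PDZ PJ Psep.
have [_ _ JM] := jacobson_radical_left_ideal R.
pose Q (fU : form * {vspace R}) :=
  P fU.1 /\ forall x, x \in fU.2 <-> form_kernel fU.1 x.
have [|[f U] /= [Pf /= UN] minU] := @ex_minimizer _ Q (fun fU => \dim fU.2).
  have [U UN] := left_ideal_vspace (form_kernel_left_ideal 0).
  by exists (0, U).
exists f => //; apply: contrapT => nNJ.
have [tf fJ] := PJ f Pf.
have lN := form_kernel_left_ideal f.
have sJN g : P g -> J `<=` form_kernel g.
  by move=> /PJ[_ gJ] x Jx r; apply: gJ; exact: JM.
have [e Ne eP] := radical_right_unit lN (sJN f Pf).
have [g Pg [y Ny gy]] := Psep _ lN (sJN f Pf) nNJ.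
pose E : set R := [set x | J (x * e)].
have lE : left_ideal E.
  split=> [|a b /= Ja Jb|a b /= Jb]; rewrite /E /=.
  - by rewrite mul0r; case: (jacobson_radical_left_ideal R).
  - by rewrite mulrBl; exact: jacobson_radicalB.
  - by rewrite -mulrA; exact: JM.
have [V VE] := left_ideal_vspace lE.
have [W WJ] := left_ideal_vspace (jacobson_radical_left_ideal R).
have sWV : (W <= V)%VS.
  by apply/subvP => x /WJ Jx; apply/VE; exact: jacobson_radicalMr.
pose C := (V :\: W)%VS; pose X := vbasis C.
have VCJ v : v \in V -> exists2 c, c \in C & J (v - c).
  rewrite -(addv_diff_cap V W) => /memv_addP[c Cc [w]].
  rewrite memv_cap => /andP[_ /WJ Jw] ->.
  by exists c => //; rewrite addrC addKr.
have ecompl r : r - r * e \in V.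
  by apply/VE; rewrite /E /= mulrBl -mulrA -mulrBr; apply: JM; exact: eP.
have CV c : c \in C -> c \in V by apply: (subvP (diffvSl V W)).
have XC i : X`_i \in C.
  have [ltin|/(nth_default 0)->] := ltnP i (size X); last exact: mem0v.
  by apply: vbasis_mem; exact: mem_nth.
(* Each [r] is a sum of [r * e], an element of [C] and one of [J]. The first and last contribute 0
   to [f (r * x)], so [x] lies in the kernel ideal, and being in [C] it must vanish. *)
have nondegC x : x \in C -> (forall c, c \in C -> f (c * x) = 0) -> x = 0.
  move=> Cx fCx; have Nx : form_kernel f x.
    move=> r; have [c Cc Jc] := VCJ _ (ecompl r).
    have -> : r * x = r * e * x + (r - r * e - c) * x + c * x.
      by rewrite -!mulrDl -addrA subrK addrC subrK.
    rewrite /= !linearD /= (fCx c) // (fJ ((_ - c) * _)) ?addr0; last first.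
      exact: jacobson_radicalMr.
    by rewrite tf mulrA; exact: Ne.
  have Jx : J x.
    rewrite -[x](subrK (x * e)); apply: jacobson_radicalD; first exact: eP.
    by apply/VE; exact: CV.
  apply/eqP; rewrite -memv0 -(capv_diff V W) memv_cap Cx.
  by apply/WJ.
pose G (h : form) : 'M[k]_(\dim C) := \matrix_(i, j) h (X`_i * X`_j).
have GE h (v : 'rV_(\dim C)) j :
    (v *m G h) 0 j = h ((\sum_i v 0 i *: X`_i) * X`_j).
  rewrite !mxE mulr_suml linear_sum; apply: eq_bigr => i _.
  by rewrite !mxE -scalerAl linearZ.
have detf : \det (G f) != 0.
  apply/det0P => -[v v0 vG]; pose x := \sum_i v 0 i *: X`_i.
  have Cx : x \in C by apply: memv_suml => i _; exact: memvZ.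
  case/eqP: v0; apply/rowP => i; rewrite !mxE.
  have /freeP := basis_free (vbasisP C); apply.
  apply: nondegC => // c Cc; rewrite tf (coord_vbasis Cc) mulr_sumr linear_sum.
  rewrite big1 // => j _; rewrite -scalerAr linearZ /= -GE vG mxE.
  exact: mulr0.
have [t t0 dett] := det_pencil (G g) k_inf detf.
pose h := f + t *: g; have Ph : P h by exact: PDZ.
have [th hJ] := PJ h Ph.
have Gh : G h = G f + t *: G g.
  by apply/matrixP => i j; rewrite !mxE add_lfunE scale_lfunE.
have nondegh x : x \in C -> form_kernel h x -> x = 0.
  move=> Cx Nx; pose v := \row_i coord X i x.
  have xE : x = \sum_i v 0 i *: X`_i.
    by rewrite {1}(coord_vbasis Cx); apply: eq_bigr => i _; rewrite mxE.
  suff v0 : v = 0 by rewrite xE v0 big1 // => i _; rewrite mxE scale0r.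
  apply/eqP; apply: contraT => v0; case/negP: dett; rewrite -Gh.
  apply/det0P; exists v => //; apply/rowP => j; rewrite GE -xE th !mxE.
  exact: Nx.
(* For [x] in the kernel ideal of [h], the [C]-component of [x - x * e] is there too, hence is 0; so
   [x - x * e] is in [J]. *)
have sNhN : form_kernel h `<=` form_kernel f.
  move=> x Nx; have [c Cc Jc] := VCJ _ (ecompl x).
  have lNh := form_kernel_left_ideal h.
  have Nxe : form_kernel h (x - x * e).
    by case: lNh => _ + _; apply => //; exact: form_kernelMr.
  have c0 : c = 0.
    apply: nondegh => //; rewrite -[c](subKr (x - x * e)).
    by case: lNh => _ + _; apply => //; exact: sJN.
  rewrite -[x](subrK (x * e)); apply: (left_idealD lN).
    by apply: (sJN f Pf); rewrite c0 subr0 in Jc.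
  by case: lN => _ _; apply.
have [U' UN'] := left_ideal_vspace (form_kernel_left_ideal h).
have sUU : (U' <= U)%VS by apply/subvP => x /UN'/sNhN/UN.
(* Minimality makes the two kernel ideals equal, although [h y = t * g y] is nonzero. *)
have /eqP UU : U' == U by rewrite eqEdim sUU (minU (h, U')).
have /UN : form_kernel f y by [].
rewrite -UU => /UN'/(_ 1); rewrite /= mul1r add_lfunE scale_lfunE.
have := Ny 1; rewrite /= mul1r => -> /eqP; rewrite add0r.
by rewrite mulf_eq0 (negPf t0) (negPf gy).
Qed.

End TraceForms.

(** * Symmetrizing forms and generators of the socle *)

Section SymmetricForms.
Variables (k : fieldType) (R : falgType k).
Local Notation J := (@jacobson_radical R).
Local Notation form := 'Hom(R, k^o).

Definition symmetrizing_form (f : form) :=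
  trace_form f /\ forall x, form_kernel f x -> x = 0.

(** Sending [x] to [f (_ * x)] is injective and linear from [R] to its dual, which has the same
    dimension. *)
Lemma symmetrizing_form_represents (f g : form) : symmetrizing_form f ->
  exists u, forall s, g s = f (s * u).
Proof.
move=> [_ f_inj].
pose F x : form := (f \o amulr x)%VF.
have FE x s : F x s = f (s * x) by rewrite comp_lfunE lfunE.
have F_lin : linear F.
  by move=> c x y; apply/lfunP => s; rewrite add_lfunE scale_lfunE !FE mulrDr
    linearD -scalerAr linearZ.
pose FL := GRing.isLinear.Build _ _ _ _ F F_lin.
pose FM : {linear R -> form} := HB.pack F FL.
have ker0 : lker (linfun FM) == 0%VS.
  apply/lker0P => x y; rewrite !lfunE /= => Fxy.
  apply/eqP; rewrite -subr_eq0; apply/eqP/f_inj => s /=.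
  by rewrite mulrBr linearB /= -!FE Fxy subrr.
have surj : limg (linfun FM) = fullv.
  apply/eqP; rewrite eqEdim subvf /= limg_dim_eq ?(eqP ker0) ?capv0 //.
  by rewrite !dimvf /dim /= muln1.
have := memvf g; rewrite -surj => /memv_imgP[u _ ->].
by exists u => s; rewrite lfunE -FE.
Qed.

(** An isomorphism [phi] is determined by [f = phi 1]; its left and right linearity express [phi x]
    as [f (_ * x)] and as [f (x * _)], whence the trace property. *)
Lemma symmetric_algebraP :
  symmetric_algebra R <-> exists f : form, symmetrizing_form f.
Proof.
split=> [[phi [phi_bij phiM]]|[f symf]].
  pose f : form := phi 1; exists f.
  have phiE x s : (phi x : form) s = f (s * x).
    rewrite -dual_lscaleE -[dual_lscale x f]/(x *: phi 1) -linearZ.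
    by congr ((phi _ : form) s); rewrite /GRing.scale /= mulr1.
  have phiE' x s : (phi x : form) s = f (x * s).
    rewrite -dual_rscaleE -[dual_rscale f x]/(rscale (phi 1) x) -phiM.
    by congr ((phi _ : form) s); rewrite -[rscale _ _]/(1 * x : R) mul1r.
  split=> [a b|x Nx]; first by rewrite -phiE phiE'.
  apply: (bij_inj phi_bij); rewrite linear0; apply/lfunP => s.
  by rewrite phiE zero_lfunE; exact: Nx.
have [tf f_inj] := symf.
pose phi (x : R^o) : dual_bimod R := dual_lscale x f.
have phi_lin : linear phi.
  by move=> a x y; rewrite /phi dual_lscaleDl -dual_lscaleA.
pose phiL := GRing.isLinear.Build _ _ _ _ phi phi_lin.
pose phiM : {linear R^o -> dual_bimod R} := HB.pack phi phiL.
exists phiM; split=> [|x b]; last first.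
  apply/lfunP => s; rewrite [RHS]dual_rscaleE !dual_lscaleE.
  by rewrite -[rscale x b]/(x * b : R) mulrA tf mulrA.
have [psi psiE] := choice (fun g => symmetrizing_form_represents g symf).
have phiK g : phi (psi g) = g by apply/lfunP => s; rewrite dual_lscaleE -psiE.
exists psi => // x; apply/eqP; rewrite -subr_eq0; apply/eqP/f_inj => s /=.
by rewrite mulrBr linearB /= -!dual_lscaleE -![dual_lscale _ f]/(phi _) phiK subrr.
Qed.

Definition socle_generator (u : R) :=
  [/\ forall r, r * u = u * r, forall r, r * u = 0 <-> J r
    & forall x, left_socle x <-> exists r, x = r * u].

Lemma pi_radical_eq (x y : R) :
  \pi_(radical_quot R)%qT x = \pi_(radical_quot R)%qT y -> J (x - y).
Proof. by move=> /eqP; rewrite -Quotient.idealrBE => /asboolP. Qed.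

(** The element [u] corresponds to the class of 1, on which left and right multiplication by [r]
    agree. *)
Lemma socle_generatorP :
  bimod_isomorphic (socle_bimod R) (radical_quot R) <->
  exists u, socle_generator u.
Proof.
split=> [[phi [phi_bij phiM]]|[u [uC uJ uS]]].
  have [psi phiK psiK] := phi_bij.
  pose m := psi (\pi_(radical_quot R)%qT 1); pose u : R := val m.
  have phil r : phi (r *: m) = \pi_(radical_quot R)%qT r.
    by rewrite linearZ psiK -[LHS]/(radical_lscale _ _) pi_radical_lscale mulr1.
  have phir r : phi (rscale m r) = \pi_(radical_quot R)%qT r.
    by rewrite phiM psiK -[LHS]/(radical_rscale _ _) pi_radical_rscale mul1r.
  have phi_inj := bij_inj phi_bij.
  exists u; split=> [r|r|x].
  - by have /phi_inj/(congr1 val) := etrans (phil r) (esym (phir r)).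
  - split=> [ru|Jr].
      rewrite -[r]subr0; apply: pi_radical_eq; rewrite -phil.
      have -> : r *: m = 0 by exact: val_inj.
      by rewrite -(scale0r m) phil.
    have /phi_inj/(congr1 val) // : phi (r *: m) = phi 0.
    rewrite -(scale0r m) !phil; apply: eq_pi_radical; by rewrite subr0.
  - split=> [Sx|[r ->]]; last first.
      by case: (left_socle_left_ideal R) => _ _; apply; apply/asboolP/(valP m).
    have Sx' : (x : R^o) \in @socle_pred R by exact/asboolP.
    exists (repr (phi (Socle Sx'))).
    have /phi_inj/(congr1 val) // :
        phi (Socle Sx') = phi (repr (phi (Socle Sx')) *: m).
    by rewrite phil reprK.
have coefP (m : socle_bimod R) : exists r, val m = r * u :> R.
  by apply/uS/asboolP/(valP m).
have [c cE] := choice coefP.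
(* The chosen coefficient is unique modulo [J], which is the annihilator of [u]. *)
pose phi m : radical_quot R := \pi_(radical_quot R)%qT (c m).
have phiE m r : val m = r * u :> R -> phi m = \pi_(radical_quot R)%qT r.
  by move=> mE; apply: eq_pi_radical; apply/uJ; rewrite mulrBl -cE mE subrr.
have phi_lin : linear phi.
  move=> a m n; rewrite (phiE _ (a * c m + c n)); last first.
    by rewrite mulrDl -mulrA -!cE.
  rewrite -[a *: phi m]/(radical_lscale a (phi m)) pi_radical_lscale.
  exact: (raddfD (\pi_(radical_quot R)%qT)).
pose phiL := GRing.isLinear.Build _ _ _ _ phi phi_lin.
pose phiM : {linear socle_bimod R -> radical_quot R} := HB.pack phi phiL.
exists phiM; split=> [|m b]; last first.
  rewrite [RHS](pi_radical_rscale (c m) b); apply: phiE.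
  by rewrite -mulrA uC mulrA -cE.
have mulS r : (r * u : R^o) \in @socle_pred R by apply/asboolP/uS; exists r.
exists (fun q => Socle (mulS (repr q))) => [m|q].
  apply: val_inj; rewrite /= [RHS]cE; apply/eqP; rewrite -subr_eq0 -mulrBl.
  by apply/eqP/uJ; exact: repr_pi_radical.
by rewrite -[RHS]reprK; exact: phiE.
Qed.

(** A scalar is absorbed into the left factor of each commutator. *)
Lemma commutator_subgroupZD (c : k) (x y : R) : commutator_subgroup R x ->
  commutator_subgroup R y -> commutator_subgroup R (c *: x + y).
Proof.
move=> [s ->] [t ->]; exists ([seq (c *: p.1, p.2) | p <- s] ++ t).
rewrite big_cat big_map scaler_sumr; congr (_ + _).
by apply: eq_bigr => p _; rewrite scalerBr scalerAl scalerAr.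
Qed.

Lemma commutators_radicalZD (c : k) (x y : R) : commutators_radical x ->
  commutators_radical y -> commutators_radical (c *: x + y).
Proof.
move=> [a ac Ja] [b bc Jb]; exists (c *: a + b).
  exact: commutator_subgroupZD.
rewrite opprD addrACA -scalerBr; apply: jacobson_radicalD => //.
by rewrite -mulr_algl; exact: jacobson_radicalMl.
Qed.

Lemma trace_form_of_commutators (f : form) :
  (forall x, commutator_subgroup R x -> f x = 0) -> trace_form f.
Proof.
move=> f0 a b; apply/eqP; rewrite -subr_eq0 -linearB /=; apply/eqP/f0.
exact: commutator_subgroup_comm.
Qed.

Lemma ex_trace_form (x : R) : ~ commutator_subgroup R x ->
  exists2 f : form, forall y, commutator_subgroup R y -> f y = 0 & f x != 0.
Proof.
have [W WP] := vspace_of_set (commutator_subgroup0 R) commutator_subgroupZD.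
move=> nWx; have [|f fW fx] := @ex_functional _ _ W x.
  by apply/negP => /WP.
by exists f => // y /WP; exact: fW.
Qed.

Lemma ex_radical_trace_form (x : R) : ~ commutators_radical x ->
  exists2 f : form, forall y, commutators_radical y -> f y = 0 & f x != 0.
Proof.
have W0 : @commutators_radical k R 0.
  by apply: radical_commutators_radical; case: (jacobson_radical_left_ideal R).
have [W WP] := vspace_of_set W0 commutators_radicalZD.
move=> nWx; have [|f fW fx] := @ex_functional _ _ W x.
  by apply/negP => /WP.
by exists f => // y /WP; exact: fW.
Qed.

Lemma symmetrizing_form_socle (f : form) : infinite_set [set: k] ->
  symmetrizing_form f -> exists u, socle_generator u.
Proof.
move=> k_inf symf; have [tf f_inj] := symf.
pose P (g : form) := forall x, commutators_radical x -> g x = 0.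
have P0 : P 0 by move=> x _; rewrite zero_lfunE.
have PDZ g h t : P g -> P h -> P (g + t *: h).
  move=> Pg Ph x Wx; rewrite add_lfunE scale_lfunE Pg // Ph //.
  by rewrite add0r; exact: mulr0.
have Ptrace g : P g -> trace_form g /\ forall x, J x -> g x = 0.
  move=> Pg; split=> [|x Jx].
    apply: trace_form_of_commutators => x cx; apply: Pg; exists x => //.
    by rewrite subrr; case: (jacobson_radical_left_ideal R).
  by apply: Pg; exact: radical_commutators_radical.
have [|g Pg gJ] := exists_trace_form k_inf P0 PDZ Ptrace.
  move=> L lL _ nLJ; have [x Lx nWx] : exists2 x, L x & ~ commutators_radical x.
    apply: contrapT => nL; apply: nLJ; apply: left_ideal_commutators_radical => //.
    by move=> x Lx; apply: contrapT => nWx; apply: nL; exists x.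
  by have [g Pg gx] := ex_radical_trace_form nWx; exists g => //; exists x.
have [tg g0] := Ptrace g Pg.
have [u uE] := symmetrizing_form_represents g symf.
have f_eq0 x : (forall s, f (s * x) = 0) -> x = 0 by move=> fx; apply: f_inj.
have uC r : r * u = u * r.
  apply/eqP; rewrite -subr_eq0; apply/eqP/f_eq0 => s.
  (* Both sides are values of [g], at [s * r] and at [r * s]. *)
  have fru : f (s * (r * u)) = f (s * (u * r)).
    by rewrite mulrA -uE tg uE -mulrA tf mulrA.
  by rewrite mulrBr linearB /= fru subrr.
have uJ r : r * u = 0 <-> J r.
  split=> [ru|Jr]; last first.
    apply: f_eq0 => s; rewrite mulrA -uE g0 //; exact: jacobson_radicalMl.
  by apply: gJ => s /=; rewrite uE -mulrA ru mulr0 linear0.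
exists u; split=> // x; split=> [Sx|[r ->]]; last first.
  by apply/left_socleE => j Jj; rewrite mulrA; apply/uJ;
    exact: jacobson_radicalMr.
pose Q x := exists r, x = r * u.
have [||W WQ] := @vspace_of_set _ R Q.
- by exists 0; rewrite mul0r.
- move=> c _ _ [r ->] [s ->]; exists (c *: r + s).
  by rewrite mulrDl scalerAl.
(* A functional [h = f (_ * y)] that vanishes on [R * u] but not at [x] has [u * y = 0], so [y] is
   in [J] and kills the socle element [x]: a contradiction. *)
apply: contrapT => nQx; have [|h hW hx] := @ex_functional _ _ W x.
  by apply/negP => /WQ.
have [y yE] := symmetrizing_form_represents h symf.
case/eqP: hx; rewrite yE tf.
have Jy : J y.
  apply/uJ; rewrite uC; apply: f_eq0 => s; rewrite mulrA -yE.
  by apply: hW; apply/WQ; exists s.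
by move/left_socleE: Sx => ->; rewrite ?linear0.
Qed.

Lemma socle_generator_symmetrizing (u : R) : infinite_set [set: k] ->
    socle_generator u ->
    (forall I : set R,
      left_ideal I -> I `<=` commutator_subgroup R -> I = [set 0]) ->
  exists f : form, symmetrizing_form f.
Proof.
move=> k_inf [uC uJ uS] noideal.
pose T (f : form) := forall x, commutator_subgroup R x -> f x = 0.
pose P (g : form) := exists2 f : form, T f & forall x, g x = f (x * u).
have P0 : P 0 by exists 0 => x; rewrite ?zero_lfunE.
have PDZ g h t : P g -> P h -> P (g + t *: h).
  move=> [f Tf gE] [f' Tf' hE]; exists (f + t *: f') => x.
    move=> cx; rewrite add_lfunE scale_lfunE Tf // Tf' //.
    by rewrite add0r; exact: mulr0.
  by rewrite !add_lfunE !scale_lfunE gE hE.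
have Ptrace g : P g -> trace_form g /\ forall x, J x -> g x = 0.
  move=> [f Tf gE]; have tf := trace_form_of_commutators Tf.
  split=> [a b|x /uJ xu]; last by rewrite gE xu linear0.
  by rewrite !gE -mulrA uC mulrA tf mulrA.
have [|g [f Tf gE] gJ] := exists_trace_form k_inf P0 PDZ Ptrace.
  move=> L lL _ nLJ; have [L0 LB LM] := lL.
  pose Lu : set R := [set l * u | l in L].
  have lLu : left_ideal Lu.
    split=> [|_ _ [a La <-] [b Lb <-]|a _ [b Lb <-]].
    - by exists 0; rewrite // mul0r.
    - by exists (a - b); [exact: LB | rewrite mulrBl].
    - by exists (a * b); [exact: LM | rewrite mulrA].
  (* If [L] is not inside [J], then [L * u] is a nonzero left ideal and so leaves the commutator
     subgroup. *)
  have [x Lx ncx] : exists2 x, L x & ~ commutator_subgroup R (x * u).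
    apply: contrapT => nL; apply: nLJ => x Lx; apply/uJ.
    have Lu0 : Lu = [set 0].
      apply: noideal => // _ [l Ll <-]; apply: contrapT => ncl.
      by apply: nL; exists l.
    by have : Lu (x * u) by [exists x]; rewrite Lu0.
  have [f Tf fx] := ex_trace_form ncx.
  have fuE y : (f \o amulr u)%VF y = f (y * u) by rewrite comp_lfunE lfunE.
  by exists (f \o amulr u)%VF; [exists f | exists x; rewrite ?fuE].
exists f; split=> [|x Nx]; first exact: trace_form_of_commutators.
have [N0|N0] := pselect (form_kernel f = [set 0]).
  by move: Nx; rewrite N0.
(* A minimal left ideal in the kernel lies in the socle [R * u]. If [r * u] is one of its elements,
   then [r] is in the kernel ideal of [g], hence in [J], so [r * u = 0]. *)
have [M mM sMN] := exists_minimal_left_ideal (form_kernel_left_ideal f) N0.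
have [[M0 MB MM] Mn0 _] := mM.
case: Mn0; apply/seteqP; split=> [z Mz|z ->//].
have [r zE] : exists r, z = r * u.
  apply/uS; exists [:: z]; last by rewrite big_seq1.
  by move=> _ /[!inE]/eqP->; exists M.
rewrite /= zE; apply/uJ; apply: gJ => s /=.
by rewrite gE -mulrA -zE; exact: sMN.
Qed.

End SymmetricForms.

Theorem theorem7 (k : fieldType) (k_infinite : infinite_set [set: k])
    (R : falgType k) :
  symmetric_algebra R <->
  bimod_isomorphic (socle_bimod R) (radical_quot R) /\
  forall I : set R,
    left_ideal I -> I `<=` commutator_subgroup R -> I = [set 0].
Proof.
rewrite symmetric_algebraP socle_generatorP; split=> [[f symf]|[[u uP] noideal]].
  split=> [|I lI sIc]; first exact: symmetrizing_form_socle symf.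
  (* A trace form vanishes on commutators, so such an ideal falls into [form_kernel f]. *)
  have [tf f_inj] := symf; have [I0 _ IM] := lI.
  apply/seteqP; split=> [x Ix|x ->//]; apply: f_inj => r /=.
  have [s ->] := sIc _ (IM r x Ix); rewrite linear_sum big1 // => p _.
  by rewrite linearB /= tf subrr.
exact: socle_generator_symmetrizing uP noideal.
Qed.
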